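(* Let $N$ be an odd positive integer and $k \ge 2$ such that \[ \sum_{i=0}^{\pi_N(k-1)-1} p_{\le k-1}(i) \equiv 0 \pmod{N}, \] and let $R \in \mathbb{Z}/N\mathbb{Z}$ be arbitrary. Let $Q = \pi'_N(k)$. Then for all integers $n, n' \ge k$ with $n' \equiv n + \pi'_N(k-1) \pmod{Q}$, \[ f_{k,R}(n+Q) - f_{k,R}(n) = f_{k,R}(n'+Q) - f_{k,R}(n'). \] (That is, the slope of the linear function $\mathcal{L}^{(i)}_{k,R}$ equals that of $\mathcal{L}^{(i')}_{k,R}$ whenever $i' \equiv i + \pi'_N(k-1) \pmod{\pi'_N(k)}$, where $f_{k,R}(n) = \mathcal{L}^{(i)}_{k,R}((n-i)/Q)$ for $n\equiv i \pmod Q$.)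
   Context: The Gaussian polynomial is $\begin{bmatrix} n \\ k \end{bmatrix}_q = \frac{[n]!}{[n-k]!\,[k]!}$ with $[m]! = \prod_{i=1}^{m} \frac{1-q^i}{1-q}$, of degree $k(n-k)$. For $n\ge k$, $f_{k,R}(n) = \#\{\alpha \in \{0,\ldots,k(n-k)\} : [q^\alpha]\begin{bmatrix} n \\ k \end{bmatrix}_q \equiv R \pmod N\}$. $p_{\le k}(n)$ is the number of partitions of $n$ with at most $k$ parts; $\pi_N(k)$ is the minimal period of the purely periodic sequence $(p_{\le k}(n) \bmod N)_{n\ge0}$ (so $\pi_N(1)=1$). Define $\pi'_N(1)=1$ and for $k\ge2$: $\pi'_N(k) = \frac{\pi_N(k)}{\pi_N(k-1)}\pi'_N(k-1)$ if $N$ divides $\frac{\pi_N(k)}{\pi_N(k-1)}$, and $\pi'_N(k) = N\frac{\pi_N(k)}{\pi_N(k-1)}\pi'_N(k-1)$ otherwise. For $n \equiv i \pmod Q$ with $0\le i<Q$, $f_{k,R}(n) = \mathcal{L}^{(i)}_{k,R}((n-i)/Q)$ with $\mathcal{L}^{(i)}_{k,R}$ an affine function. *)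

(* Defs.v *)
From mathcomp Require Import all_boot all_order all_algebra.
From mathcomp Require Import boolp classical_sets.

Set Implicit Arguments.
Unset Strict Implicit.
Unset Printing Implicit Defensive.

Import GRing.Theory.

(* The divisors in the next two definitions have leading coefficient 1 or -1,
   a unit of int, so [%/] on {poly int} is genuine Euclidean division, and it
   is exact. *)
Definition qfact (m : nat) : {poly int} :=
  (\prod_(1 <= i < m.+1) ((1 - 'X^i) %/ (1 - 'X)))%R.

(* Meaningful for k <= n only. *)
Definition gauss (n k : nat) : {poly int} :=
  (qfact n %/ (qfact (n - k) * qfact k))%R.

(* A residue class modulo N is given by any representative R : int. *)
Definition gauss_count (N k : nat) (R : int) (n : nat) : nat :=
  #|[set a : 'I_(k * (n - k)).+1 | ((gauss n k)`_a == R %[mod N])%Z]|.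

Definition is_partition (n : nat) (s : seq nat) : bool :=
  [&& sorted geq s, all (leq 1) s & sumn s == n].

(* The parts of a partition of n are at most n, so they live in 'I_n.+1;
   k.-bseq is the type of sequences of size at most k. *)
Definition npart_le (k n : nat) : nat :=
  #|[set s : k.-bseq 'I_n.+1 | is_partition n (map val s)]|.

Definition is_period (u : nat -> nat) (T : nat) : Prop :=
  0 < T /\ forall n, u (n + T) = u n.

Definition is_min_period (u : nat -> nat) (T : nat) : Prop :=
  is_period u T /\ forall T', is_period u T' -> T <= T'.

(* 0 if u is not purely periodic. *)
Definition min_period (u : nat -> nat) : nat :=
  xget 0 [set T | is_min_period u T]%classic.

Definition npart_period (N k : nat) : nat :=
  min_period (fun n => npart_le k n %% N).

(* This is pi'_N(k); the value at k = 0 is junk.  The ratio is exact, since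
   npart_le k.+1 (n + k.+1) = npart_le k.+1 n + npart_le k (n + k.+1). *)
Fixpoint npart_period' (N k : nat) : nat :=
  match k with
  | 0 | 1 => 1
  | j.+1 =>
      let r := npart_period N j.+1 %/ npart_period N j in
      if N %| r then r * npart_period' N j else N * r * npart_period' N j
  end.

(* Main.v *)
(* With (q)_k = (1-q)...(1-q^k) and V_j = (q)_j (q)_(k-j), the q-binomial
   theorem expands the Gaussian polynomial G_n as the sum over j of
   (-1)^j q^(s_j) / V_j, where s_j = j(n-k+1) + C(j,2).  Modulo N each 1/V_j is
   purely periodic with period Q, so on the j-th window [s_j, s_(j+1)), of
   length n-k+1+j, the coefficients of G_n are
     g_(j,n)(m) = sum_(i <= j) (-1)^i a_i(s_j - s_i + m),
   with a_i(m) = [q^m] 1/V_i.  Going from n to n+Q lengthens every window by one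
   period, so f(n+Q) - f(n) counts, over all j < k, the m in a period with
   g_(j,n)(m) = R.  Write T' = pi'_N(k-1).  If a_i has period i T' for all
   i < k, then g_(j,n+T')(m) = g_(j,n)(m + j T'), and these counts agree for n
   and n + T'.
     That period amounts to V_i | 1 - q^(i T') mod N.  For i = 1 and i = k-1,
   V_i = (1-q)(q)_(k-1), and the hypothesis says precisely that the cofactor of
   (q)_(k-1) in 1 - q^(pi_N(k-1)) vanishes at q = 1.  For 1 < i < k-1, put
   L = lcm(1,...,k-2) and z = q^L: then V_i | (1-z)^k, which divides 1 - z^M
   mod N as soon as N | C(M,l) for 0 < l < k; this holds for M = T'/L because
   N^(k-2) | T' and N is odd. *)

Require Import Defs.
From mathcomp Require Import all_boot all_order all_algebra.
From mathcomp Require boolp classical_sets.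
From mathcomp Require Import zify ring.

Set Implicit Arguments.
Unset Strict Implicit.
Unset Printing Implicit Defensive.

Import GRing.Theory.

(** * Divisibility and inverse power series *)

Section Series.
Local Open Scope ring_scope.
Variable K : comNzRingType.
Implicit Types (V W A P : {poly K}) (u : nat -> K).

Definition qdvd V W := exists A, W = A * V.

Lemma qdvd_refl V : qdvd V V.
Proof. by exists 1; rewrite mul1r. Qed.

Lemma qdvd_trans V W P : qdvd V W -> qdvd W P -> qdvd V P.
Proof. by move=> [A ->] [B ->]; exists (B * A); rewrite mulrA. Qed.

Lemma qdvd_mulr V W : qdvd V (V * W).
Proof. by exists W; rewrite mulrC. Qed.

Lemma qdvd_mul V1 V2 W1 W2 : qdvd V1 W1 -> qdvd V2 W2 -> qdvd (V1 * V2) (W1 * W2).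
Proof. by move=> [A ->] [B ->]; exists (A * B); rewrite mulrACA. Qed.

Lemma qdvd_exp1 (z : {poly K}) m n : (m %| n)%N -> qdvd (1 - z ^+ m) (1 - z ^+ n).
Proof.
case/dvdnP=> c ->; exists (\sum_(i < c) (z ^+ m) ^+ i).
by rewrite mulnC exprM -[LHS]opprB subrX1 -mulNr opprB mulrC.
Qed.

Lemma qdvd_1subXn m n : (m %| n)%N -> qdvd (1 - 'X^m) (1 - 'X^n).
Proof. exact: qdvd_exp1. Qed.

(** [1 - 'X^i] has leading coefficient -1; admitting both signs gives cancellation and size formulas
    even over Z/N, which may have zero divisors. *)
Definition pm_monic P := (P \is monic) || (- P \is monic).

Lemma pm_monicM P W : pm_monic P -> pm_monic W -> pm_monic (P * W).
Proof.
rewrite /pm_monic => /orP[] hP /orP[] hW.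
- by rewrite monicMl // hW.
- by rewrite -mulrN [X in _ || X]monicMl // hW orbT.
- by rewrite -mulNr [X in _ || X]monicMl // hW orbT.
- by rewrite -mulrNN monicMl // hW.
Qed.

Lemma pm_monic_1subXn i : pm_monic (1 - 'X^(i.+1)).
Proof. by rewrite /pm_monic opprB monicXnsubC ?orbT. Qed.

Lemma pm_monic_inj P A B : pm_monic P -> A * P = B * P -> A = B.
Proof.
move=> /orP[] hP; first by rewrite ![_ * P]mulrC; exact: (monic_lreg hP).
by move/(congr1 (@GRing.opp _)); rewrite -!mulrN ![_ * - P]mulrC; exact: (monic_lreg hP).
Qed.

Lemma pm_size A P : pm_monic P -> A != 0 -> size (A * P) = (size A + size P).-1.
Proof.
move=> /orP[] hP hA; first exact: size_Mmonic.
by rewrite -[LHS]size_polyN -mulrN size_Mmonic // size_polyN.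
Qed.

Lemma size_1subXn n : (size (1 - 'X^n : {poly K})%R <= n.+1)%N.
Proof.
by rewrite (leq_trans (size_polyD _ _)) // size_polyN size_polyXn size_poly1 geq_max ltnS leqnn.
Qed.

Lemma size_cofactor A P T : pm_monic P -> (1 < size P)%N ->
  A * P = 1 - 'X^T -> (size A <= T)%N.
Proof.
move=> hP sP e; have [->|hA] := eqVneq A 0; first by rewrite size_poly0.
have := size_1subXn T; rewrite -e pm_size //; lia.
Qed.

(** For [size A <= T], this is the coefficient of q^m in the power series A / (1 - q^T). *)
Definition rep_coef A T (m : nat) : K := A`_(m %% T).

Lemma rep_coefE A T M : (0 < T)%N -> (size A <= T)%N ->
  A * \sum_(c < M) ('X^T) ^+ c = \poly_(m < M * T) rep_coef A T m.
Proof.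
move=> T0 sA; elim: M => [|M IH].
  by rewrite big_ord0 mulr0 mul0n; apply/polyP=> i; rewrite coef0 coef_poly.
rewrite big_ord_recr mulrDr IH -exprM /=.
apply/polyP=> i; rewrite coefD coefMXn !coef_poly.
have [h|h] := ltnP i (M * T).
  by rewrite mulnC h addr0 (leq_trans h) // leq_mul2r leqnSn orbT.
rewrite mulnC ltnNge h /= add0r /rep_coef.
have [h2|h2] := ltnP i (M.+1 * T).
  congr (A`_ _); rewrite -{2}(subnK h) addnC modnMDl modn_small //.
  by rewrite ltn_subLR // -mulSnr.
by rewrite nth_default // (leq_trans sA) // leq_subRL // -mulSnr.
Qed.

Lemma geom_1subXn T M : (1 - 'X^T : {poly K}) * (\sum_(c < M) ('X^T) ^+ c) = 1 - 'X^(M * T).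
Proof. by rewrite mulnC exprM -[RHS]opprB subrX1 -mulNr opprB. Qed.

(** Congruence modulo q^M: power series are handled through their truncations. *)
Definition eqX M P W := forall m, (m < M)%N -> P`_m = W`_m.

Lemma eqX_mull M A P W : eqX M P W -> eqX M (A * P) (A * W).
Proof.
move=> h m hm; rewrite !coefM; apply: eq_bigr => i _; rewrite h //.
exact: leq_ltn_trans (leq_subr _ _) hm.
Qed.

Lemma eqX_mulr M A P W : eqX M P W -> eqX M (P * A) (W * A).
Proof. by rewrite ![_ * A]mulrC; exact: eqX_mull. Qed.

Lemma eqX_1subXn M P : eqX M ((1 - 'X^M) * P) P.
Proof. by move=> m hm; rewrite mulrBl mul1r coefB coefXnM hm subr0. Qed.

(* [u] is the coefficient sequence of the power series [1 / V]. *)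
Definition inv_series V u := forall M, eqX M (V * \poly_(i < M) u i) 1.

(** Modulo q^(m+1), U = U V W = W for the two truncated inverses U and W. *)
Lemma inv_series_uniq V u w : inv_series V u -> inv_series V w -> u =1 w.
Proof.
move=> hu hw m; pose P v : {poly K} := \poly_(i < m.+1) v i.
have hP : eqX m.+1 (P u) (P w).
  move=> i hi; have <- : (P u * (V * P w))`_i = (P u)`_i.
    by rewrite (eqX_mull _ (hw m.+1)) // mulr1.
  by rewrite mulrCA mulrA (eqX_mulr _ (hu m.+1)) // mul1r.
by have := hP m (leqnn _); rewrite !coef_poly leqnn.
Qed.

Lemma eqX_poly V u M N : (M <= N)%N -> eqX M (\poly_(i < M) u i) (\poly_(i < N) u i).
Proof. by move=> h m hm; rewrite !coef_poly hm (leq_trans hm h). Qed.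

Lemma inv_series_le V u :
  (forall M, exists2 N, (M <= N)%N & eqX M (V * \poly_(i < N) u i) 1) -> inv_series V u.
Proof.
move=> h M m hm; have [N hMN hN] := h M.
by rewrite -(hN m hm); apply: eqX_mull hm; apply: eqX_poly.
Qed.

Lemma inv_series_rep_coef V A T : (0 < T)%N -> (size A <= T)%N ->
  A * V = 1 - 'X^T -> inv_series V (rep_coef A T).
Proof.
move=> T0 sA e; apply: inv_series_le => M.
exists (M * T)%N; first by rewrite leq_pmulr.
rewrite -rep_coefE // mulrA (mulrC V) e geom_1subXn => m hm.
have := @eqX_1subXn (M * T) 1 m; rewrite mulr1; apply.
by rewrite (leq_trans hm) // leq_pmulr.
Qed.

Lemma rep_coef_poly u T m : (0 < T)%N -> (forall n, u (n + T)%N = u n) ->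
  rep_coef (\poly_(i < T) u i) T m = u m.
Proof.
move=> T0 per; rewrite /rep_coef coef_poly ltn_mod T0.
have perM c n : u (n + c * T)%N = u n by elim: c n => [|c IH] n; rewrite ?addn0 // mulSn addnA IH per.
by rewrite {2}(divn_eq m T) addnC perM.
Qed.

(** Multiplying by 1 - q^(MT) with MT > m leaves coefficient m alone, and turns one period [A] of
    [u] into (1 - q^T) times a truncation of 1 / V. *)
Lemma inv_series_periodic V u T : (0 < T)%N -> inv_series V u ->
  (forall n, u (n + T)%N = u n) -> \poly_(i < T) u i * V = 1 - 'X^T.
Proof.
move=> T0 hu per; pose A : {poly K} := \poly_(i < T) u i.
apply/polyP=> m; rewrite -/A.
pose M := m.+1; have hM : (m < M * T)%N by rewrite (leq_trans _ (leq_pmulr _ T0)).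
have eA : A * \sum_(c < M) ('X^T) ^+ c = \poly_(i < M * T) u i.
  rewrite rep_coefE // ?size_poly //; apply/polyP=> i; rewrite !coef_poly.
  by rewrite rep_coef_poly.
have <- : ((1 - 'X^(M * T)) * (A * V))`_m = (A * V)`_m by apply: (@eqX_1subXn (M * T)).
rewrite -geom_1subXn -mulrA (mulrA _ A) (mulrC _ A) eA [_ * V]mulrC.
by rewrite (eqX_mull _ (hu (M * T)%N)) // mulr1.
Qed.

(** The bridge between periods and divisibility. As [1 < size V], the cofactor of V in 1 - q^T has
    at most T coefficients, so it is one period of 1 / V. *)
Lemma inv_series_periodP V u T : pm_monic V -> (1 < size V)%N -> (0 < T)%N ->
  inv_series V u -> qdvd V (1 - 'X^T) <-> (forall n, u (n + T)%N = u n).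
Proof.
move=> mV sV T0 hu; split=> [[A e] n | per]; last first.
  by exists (\poly_(i < T) u i); rewrite inv_series_periodic.
have sA : (size A <= T)%N by apply: (@size_cofactor A V).
have hw : inv_series V (rep_coef A T) by apply: inv_series_rep_coef.
by rewrite !(inv_series_uniq hu hw) /rep_coef modnDr.
Qed.

End Series.

(** * The q-binomial theorem *)

Section Gauss.
Local Open Scope ring_scope.

Definition qpoch (K : comNzRingType) (k : nat) : {poly K} :=
  \prod_(i < k) (1 - 'X^(i.+1)).

(** The q-Pascal rule needs no division, so it makes sense over Z/N. *)
Fixpoint gbin (K : comNzRingType) (n k : nat) : {poly K} :=
  match n, k with
  | _, 0 => 1
  | 0, _.+1 => 0
  | n.+1, k.+1 => gbin K n k + 'X^(k.+1) * gbin K n k.+1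
  end.

Variable K : comNzRingType.

Lemma qpochS k : qpoch K k.+1 = qpoch K k * (1 - 'X^(k.+1)).
Proof. by rewrite /qpoch big_ord_recr. Qed.

Lemma pm_monic_qpoch k : pm_monic (qpoch K k).
Proof.
elim: k => [|k IH]; first by rewrite /qpoch big_ord0 /pm_monic monic1.
by rewrite qpochS; apply: pm_monicM => //; apply: pm_monic_1subXn.
Qed.

Lemma size_1subXnS i : size (1 - 'X^(i.+1) : {poly K}) = i.+2.
Proof. by rewrite -size_polyN opprB size_XnsubC. Qed.

Lemma size_qpoch_gt1 k : (0 < k)%N -> (1 < size (qpoch K k))%N.
Proof.
elim: k => // -[|k] IH _; first by rewrite /qpoch big_ord1 size_1subXnS.
rewrite qpochS pm_size ?size_1subXnS ?pm_monic_1subXn //; last first.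
  by rewrite -size_poly_gt0 (leq_trans _ (IH _)).
by have := IH isT; lia.
Qed.

Lemma qdvd_qpoch m n : (m <= n)%N -> qdvd (qpoch K m) (qpoch K n).
Proof.
move=> /subnKC <-; elim: (n - m)%N => [|d IH]; first by rewrite addn0; apply: qdvd_refl.
by rewrite addnS qpochS; apply: (qdvd_trans IH); apply: qdvd_mulr.
Qed.

Lemma gbin0 n : gbin K n 0 = 1. Proof. by case: n. Qed.

Lemma gbinS n k : gbin K n.+1 k.+1 = gbin K n k + 'X^(k.+1) * gbin K n k.+1.
Proof. by []. Qed.

Lemma gbin_small n k : (n < k)%N -> gbin K n k = 0.
Proof.
elim: n k => [|n IH] [|k] //= h.
by rewrite !IH ?mulr0 ?addr0 // ltnW.
Qed.

Lemma gbinn n : gbin K n n = 1.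
Proof. by elim: n => //= n ->; rewrite gbin_small // mulr0 addr0. Qed.

Lemma gbin_fact k l : gbin K (k + l) k * (qpoch K k * qpoch K l) = qpoch K (k + l).
Proof.
have [n] := ubnP (k + l); elim: n k l => // n IH [|k] [|l] hn.
- by rewrite /qpoch !big_ord0 !mulr1.
- by rewrite gbin0 {1}/qpoch big_ord0 !mul1r.
- by rewrite addn0 gbinn mul1r {2}/qpoch big_ord0 mulr1.
rewrite addSn gbinS mulrDl.
have e1 := IH k l.+1 ltac:(lia); have e2 := IH k.+1 l ltac:(lia).
rewrite {1}qpochS (qpochS l) (qpochS (k + l.+1)).
have -> : gbin K (k + l.+1) k * (qpoch K k * (1 - 'X^(k.+1)) * (qpoch K l * (1 - 'X^(l.+1))))
  = qpoch K (k + l.+1) * (1 - 'X^(k.+1)) by rewrite -e1 (qpochS l); ring.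
rewrite addSnnS in e2.
have -> : 'X^(k.+1) * gbin K (k + l.+1) k.+1 * (qpoch K k.+1 * (qpoch K l * (1 - 'X^(l.+1))))
  = qpoch K (k + l.+1) * ('X^(k.+1) * (1 - 'X^(l.+1))) by rewrite -e2; ring.
(* With a = k + 1 and b = l + 1: (1 - q^a) + q^a (1 - q^b) = 1 - q^(a+b). *)
rewrite -mulrDr -addSn exprD; congr (_ * _); ring.
Qed.

(* The q-binomial theorem; the factor (1 - x) is split off first, which
   matches the Pascal recursion defining [gbin]. *)
Lemma gauss_binomial k (x : {poly K}) :
  \prod_(i < k) (1 - x * 'X^i) =
  \sum_(j < k.+1) (-1) ^+ j * 'X^('C(j, 2)) * gbin K k j * x ^+ j.
Proof.
elim: k x => [|k IH] x.
  by rewrite big_ord0 big_ord_recl big_ord0 /= bin0n expr0 !mulr1 addr0.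
rewrite big_ord_recl expr0 mulr1.
have -> : \prod_(i < k) (1 - x * 'X^(lift ord0 i)) = \prod_(i < k) (1 - (x * 'X) * 'X^i).
  by apply: eq_bigr => i _; rewrite lift0 exprS mulrA.
rewrite IH mulrBl mul1r.
pose F j := (-1) ^+ j * 'X^('C(j, 2)) * gbin K k j * (x * 'X) ^+ j.
pose G j := (-1) ^+ j * 'X^('C(j, 2)) * gbin K k.+1 j * x ^+ j.
(* The q-Pascal rule term by term: [F] holds the terms of the expansion at x q, [G] those for k + 1
   at x. *)
have HG j : G j.+1 = F j.+1 - x * F j.
  rewrite /G /F gbinS (binS j 1) bin1 !exprMn !exprD !exprS; ring.
rewrite -/(F _) big_ord_recl [RHS]big_ord_recl /=.
have -> : \sum_(i < k.+1) (-1) ^+ bump 0 i * 'X^('C(bump 0 i, 2)) *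
   match bump 0 i with 0 => 1 | k0.+1 => gbin K k k0 + 'X^(k0.+1) * gbin K k k0.+1 end * x ^+ bump 0 i
   = \sum_(i < k.+1) (F i.+1 - x * F i) by apply: eq_bigr => i _; rewrite -HG.
rewrite sumrB -mulr_sumr -/(F 0).
rewrite [\sum_(i < k.+1) F i.+1]big_ord_recr /=.
have -> : F k.+1 = 0 by rewrite /F gbin_small // mulr0 mul0r.
rewrite addr0 /F big_ord_recl /= gbin0 !expr0 !mulr1; ring.
Qed.

Lemma qpoch_shift m k :
  qpoch K (m + k) = qpoch K m * \prod_(i < k) (1 - 'X^(m.+1) * 'X^i).
Proof.
elim: k => [|k IH]; first by rewrite addn0 big_ord0 mulr1.
by rewrite addnS qpochS IH big_ord_recr /= mulrA -exprD addSn.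
Qed.

Lemma gbin_numerator n k : (k <= n)%N ->
  gbin K n k * qpoch K k = \prod_(i < k) (1 - 'X^((n - k).+1) * 'X^i).
Proof.
move=> h; apply: (pm_monic_inj (pm_monic_qpoch (n - k))).
have := gbin_fact k (n - k); rewrite subnKC // => e.
by rewrite -mulrA e -{1}(subnK h) qpoch_shift mulrC.
Qed.

(* With [t = n - k + 1], the least exponent in the [j]-th term of the
   numerator of the Gaussian polynomial. *)
Definition wstart t j := (j * t + 'C(j, 2))%N.

(** The q-binomial theorem at x = q^(n-k+1) expands the numerator; [A j] turns the factor (1 - q^Q)
    [gbin K k j] of each term into [A j] (q)_k, and (q)_k cancels. *)
Lemma gbin_expansion n k Q (A : nat -> {poly K}) : (k <= n)%N ->
  (forall j, (j <= k)%N -> A j * (qpoch K j * qpoch K (k - j)) = 1 - 'X^Q) ->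
  (1 - 'X^Q) * gbin K n k = \sum_(j < k.+1) (-1) ^+ j * ('X^(wstart (n - k).+1 j) * A j).
Proof.
move=> h hA; apply: (pm_monic_inj (pm_monic_qpoch k)).
rewrite -mulrA gbin_numerator // gauss_binomial mulr_sumr mulr_suml.
apply: eq_bigr => -[j hj] _ /=; rewrite ltnS in hj.
have := gbin_fact j (k - j); rewrite subnKC // => e.
rewrite -(hA j hj) -[in RHS]e /wstart exprD mulnC exprM; ring.
Qed.

Lemma size_gbin n k : (k <= n)%N -> (size (gbin K n k) <= (k * (n - k)).+1)%N.
Proof.
elim: n k => [|n IH] [|k] //= h; rewrite ?size_poly1 //.
rewrite (leq_trans (size_polyD _ _)) // geq_max; apply/andP; split.
  by rewrite (leq_trans (IH k h)) // subSS ltnS leq_mul2r leqnSn orbT.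
have [hk|hk] := leqP k.+1 n; last by rewrite gbin_small // mulr0 size_poly0.
rewrite subSS mulrC.
have [->|nz] := eqVneq (gbin K n k.+1) 0; first by rewrite mul0r size_poly0.
rewrite size_Mmonic ?monicXn // size_polyXn.
by have := IH k.+1 hk; rewrite -(subnSK hk) mulnS; lia.
Qed.

End Gauss.

(** * The integer Gaussian polynomials of the statement *)

Section GaussInt.
Local Open Scope ring_scope.

Lemma pm_monic_lead (P : {poly int}) : pm_monic P -> lead_coef P \is a GRing.unit.
Proof.
by case/orP=> /monicP h; [rewrite h unitr1 | rewrite -unitrN -lead_coefN h unitr1].
Qed.

Lemma qfactE m : qfact m * (1 - 'X) ^+ m = qpoch int m.
Proof.
rewrite /qfact /qpoch big_add1 big_mkord.
rewrite -[m in (1 - 'X) ^+ m]card_ord -prodr_const -big_split /=; apply: eq_bigr => i _.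
have e : 1 - 'X^(i.+1) = (\sum_(c < i.+1) 'X^c) * (1 - 'X) :> {poly int}.
  by rewrite mulrC -[LHS]opprB subrX1 -mulNr opprB.
by rewrite {1}e Pdiv.IdomainUnit.mulpK // pm_monic_lead // -['X]expr1 pm_monic_1subXn.
Qed.

Lemma lead_coef_qfact m : lead_coef (qfact m) \is a GRing.unit.
Proof.
have := pm_monic_lead (pm_monic_qpoch int m).
by rewrite -qfactE lead_coefM unitrM => /andP[].
Qed.

(** After multiplication by (1 - q)^n the q-factorials become [qpoch], and [gbin_fact] applies. *)
Lemma gaussE n k : (k <= n)%N -> gauss n k = gbin int n k.
Proof.
move=> h; rewrite /gauss.
have -> : qfact n = gbin int n k * (qfact (n - k) * qfact k).
  apply: (@pm_monic_inj _ ((1 - 'X) ^+ n)).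
    elim: n {h} => [|n IH]; first by rewrite /pm_monic monic1.
    by rewrite exprS; apply: pm_monicM => //; rewrite -['X]expr1 pm_monic_1subXn.
  rewrite qfactE -{1}(subnKC h) -gbin_fact -!qfactE subnKC //.
  have -> : (1 - 'X : {poly int}) ^+ n = (1 - 'X) ^+ k * (1 - 'X) ^+ (n - k).
    by rewrite -exprD subnKC.
  ring.
by rewrite Pdiv.IdomainUnit.mulpK // lead_coefM unitrM !lead_coef_qfact.
Qed.

Lemma map_gbin (K : comNzRingType) n k :
  map_poly (intr : int -> K) (gbin int n k) = gbin K n k.
Proof.
elim: n k => [|n IH] [|k] /=; rewrite ?rmorph1 ?rmorph0 //.
by rewrite rmorphD rmorphM /= map_polyXn !IH.
Qed.

End GaussInt.

(** * Partitions with at most k parts *)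

Section Partitions.

(** Plain sequences instead of bounded ones over an ordinal type, so that partitions of different n
    can be compared. *)
Definition part_list k n : seq (seq nat) :=
  [seq map val (bseqval s) |
     s <- enum [set s : k.-bseq 'I_n.+1 | is_partition n (map val s)]].

Lemma size_part_list k n : size (part_list k n) = npart_le k n.
Proof. by rewrite size_map /npart_le cardE. Qed.

Lemma part_list_uniq k n : uniq (part_list k n).
Proof.
rewrite map_inj_uniq ?enum_uniq // => s t e.
by apply: val_inj; apply: (inj_map val_inj) e.
Qed.

Lemma leq_sumn (s : seq nat) x : x \in s -> x <= sumn s.
Proof.
elim: s => //= y s IH; rewrite inE => /orP[/eqP ->|/IH h]; first exact: leq_addr.
exact: leq_trans h (leq_addl _ _).
Qed.

Lemma mem_part_list k n s :
  (s \in part_list k n) = is_partition n s && (size s <= k).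
Proof.
apply/mapP/andP => [[t] | [hs hk]].
  by rewrite mem_enum inE => ht ->; split=> //; rewrite size_map size_bseq.
have ht : map val (map (@inord n) s) = s.
  rewrite -map_comp -[RHS]map_id; apply/eq_in_map => x hx /=.
  rewrite inordK // ltnS; case/and3P: hs => _ _ /eqP <-; exact: leq_sumn.
have hk' : size (map (@inord n) s) <= k by rewrite size_map.
by exists (Bseq hk') => //=; rewrite mem_enum inE /= ht.
Qed.

(** For [size s <= m], this puts a new first column of height m in front of the Young diagram of
    [s]. *)
Definition add_column m (s : seq nat) := map S (s ++ nseq (m - size s) 0).

Lemma sumn_mapS t : sumn (map S t) = sumn t + size t.
Proof. by elim: t => //= x t ->; lia. Qed.

Lemma geq_trans : transitive geq.
Proof. by move=> y x z /= h1 h2; apply: leq_trans h2 h1. Qed.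

Lemma sorted_geq_mapS t : sorted geq (map S t) = sorted geq t.
Proof. by rewrite sorted_map. Qed.

Lemma sorted_geq_nseq0 s m : sorted geq (s ++ nseq m 0) = sorted geq s.
Proof.
rewrite !(sorted_pairwise geq_trans) pairwise_cat.
have -> : allrel geq s (nseq m 0).
  by apply/allrelP => x y _ /nseqP[-> _] /=.
have -> : pairwise geq (nseq m 0) by elim: m => //= m ->; rewrite all_nseq orbT.
by rewrite andbT.
Qed.

(** Lowering every entry by one and dropping the zeros recovers the partition. *)
Lemma add_column_inj m s t : all (leq 1) s -> all (leq 1) t ->
  add_column m s = add_column m t -> s = t.
Proof.
have fK u : all (leq 1) u -> [seq x <- map predn (add_column m u) | 1 <= x] = u.
  move=> hu; rewrite -map_comp map_id_in //; rewrite filter_cat.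
  by rewrite (all_filterP hu) filter_nseq /= cats0.
by move=> hs ht e; rewrite -(fK s) // e fK.
Qed.

Lemma add_column_part m n s : m <= n -> is_partition (n - m) s -> size s <= m ->
  is_partition n (add_column m s) && (size (add_column m s) == m).
Proof.
move=> hmn /and3P[h1 h2 /eqP h3] hs.
have es : size (add_column m s) = m by rewrite size_map size_cat size_nseq subnKC.
rewrite es eqxx andbT /is_partition sorted_geq_mapS sorted_geq_nseq0 h1 /=.
rewrite sumn_mapS sumn_cat sumn_nseq mul0n addn0 h3 size_cat size_nseq subnKC // subnK // eqxx andbT.
by rewrite all_map; apply/allP.
Qed.

Lemma sorted_geq_zeros t : sorted geq t ->
  t = [seq x <- t | 1 <= x] ++ nseq (size t - size [seq x <- t | 1 <= x]) 0.
Proof.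
elim: t => //= -[|x] t IH h /=; last by rewrite subSS -IH // (path_sorted h).
have h0 : all (pred1 0) t.
  by apply: sub_all (order_path_min geq_trans h) => y /=; rewrite leqn0.
have -> : [seq x <- t | 0 < x] = [::].
  by apply/eqP; rewrite -size_eq0 size_filter eqn0Ngt -has_count -all_predC;
     apply: sub_all h0 => y /= /eqP ->.
by rewrite [RHS]/=; congr (_ :: _); exact/all_pred1P.
Qed.

Lemma del_column_part m n s : is_partition n s -> size s = m ->
  m <= n /\ exists2 t, is_partition (n - m) t && (size t <= m) & s = add_column m t.
Proof.
move=> /and3P[h1 h2 /eqP h3] hs.
have es : s = map S (map predn s).
  rewrite -map_comp -[LHS]map_id; apply/eq_in_map => x hx /=.
  by rewrite prednK // (allP h2).
have hn : n = sumn (map predn s) + m by rewrite -h3 {1}es sumn_mapS size_map hs.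
have st : sorted geq (map predn s) by rewrite -sorted_geq_mapS -es.
have e := sorted_geq_zeros st.
set t := [seq x <- map predn s | 1 <= x] in e.
have sz : size t <= m by rewrite size_filter -hs -(size_map predn s) count_size.
split; first by rewrite hn leq_addl.
exists t; last by rewrite {1}es /add_column {1}e size_map hs.
rewrite sz andbT /is_partition -(sorted_geq_nseq0 t (size (map predn s) - size t)) -e st /=.
rewrite filter_all /= hn addnK [in X in _ == X]e sumn_cat sumn_nseq mul0n addn0 eqxx //.
Qed.

Lemma npart_le0 n : npart_le 0 n = (n == 0).
Proof.
rewrite -size_part_list.
case: n => [|n].
  rewrite (@perm_size _ _ [:: [::]]) //; apply: uniq_perm; rewrite ?part_list_uniq //.
  by move=> s; rewrite mem_part_list leqn0 size_eq0 inE; case: eqP => [->|]; rewrite ?andbF.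
rewrite (@perm_size _ _ [::]) //; apply: uniq_perm; rewrite ?part_list_uniq //.
by move=> s; rewrite mem_part_list leqn0 size_eq0 in_nil; case: eqP => [->|]; rewrite ?andbF.
Qed.

(** Partitions with exactly k + 1 parts are those whose first column has height k + 1; that column
    can be removed. *)
Lemma npart_leS k n : npart_le k.+1 n =
  npart_le k n + (if k < n then npart_le k.+1 (n - k.+1) else 0).
Proof.
pose l := if k < n then map (add_column k.+1) (part_list k.+1 (n - k.+1)) else [::].
have -> : (if k < n then npart_le k.+1 (n - k.+1) else 0) = size l.
  rewrite /l; case: (k < n) => //. rewrite size_map size_part_list. by [].
have mem_l s : (s \in l) = is_partition n s && (size s == k.+1).
  apply/idP/idP => [|/andP[hs /eqP sz]].
    rewrite /l; case: ifP => // hk /mapP[t]; rewrite mem_part_list => /andP[h1 h2] ->.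
    exact: add_column_part.
  have [hk [t ht ->]] := del_column_part hs sz.
  by rewrite /l hk map_f // mem_part_list.
rewrite -!size_part_list -size_cat; apply: perm_size; apply: uniq_perm.
- exact: part_list_uniq.
- rewrite cat_uniq part_list_uniq /=; apply/andP; split.
    apply/hasPn => s; rewrite mem_l mem_part_list => /andP[-> /eqP ->].
    by rewrite ltnn.
  rewrite /l; case: ifP => // _; rewrite map_inj_in_uniq ?part_list_uniq //.
  move=> s t; rewrite !mem_part_list => /andP[/and3P[_ hs _] _] /andP[/and3P[_ ht _] _].
  exact: add_column_inj.
move=> s; rewrite mem_cat mem_l !mem_part_list -andb_orr; congr (_ && _).
by rewrite leq_eqVlt orbC ltnS.
Qed.

Local Open Scope ring_scope.

(** By [npart_leS], multiplying the generating function for k + 1 by 1 - q^(k+1) gives the one for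
    k. *)
Lemma inv_series_npart (K : comNzRingType) k :
  inv_series (qpoch K k) (fun n => (npart_le k n)%:R).
Proof.
elim: k => [|k IH] M.
  move=> m hm; rewrite /qpoch big_ord0 mul1r coef_poly hm npart_le0 coef1.
  by case: eqP.
rewrite qpochS -mulrA => m hm; rewrite -(IH M m hm).
apply: eqX_mull hm => {}m hm.
rewrite mulrBl mul1r coefB coefXnM !coef_poly hm npart_leS ltnS.
have [h|h] := ltnP k m; last by rewrite addn0 subr0.
by rewrite (leq_ltn_trans (leq_subr _ _) hm) natrD addrK.
Qed.

End Partitions.

(** * Divisors of 1 - q^T *)

Section Divisibility.
Local Open Scope ring_scope.
Variable K : comNzRingType.

(** Reducing n modulo m leaves a multiple of 1 - q^m of degree below m, which must be 0. *)
Lemma qdvd_1subXn_dvdn m n : (0 < m)%N ->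
  qdvd (1 - 'X^m : {poly K}) (1 - 'X^n) -> (m %| n)%N.
Proof.
case: m => // m _ h.
have [A] : qdvd (1 - 'X^(m.+1) : {poly K}) (1 - 'X^(n %% m.+1)).
  have [B eB] := h; have [C eC] := @qdvd_1subXn K m.+1 (n %/ m.+1 * m.+1) (dvdn_mull _ (dvdnn _)).
  exists (B - 'X^(n %% m.+1) * C).
  rewrite mulrBl -eB -mulrA -eC mulrBr mulr1 -exprD addnC -divn_eq; ring.
have [->|nz] := eqVneq A 0.
  rewrite mul0r => e; rewrite /dvdn; apply/eqP.
  have := congr1 (fun p : {poly K} => p`_(n %% m.+1)) e.
  rewrite coefB coef1 coefXn eqxx coef0; case: eqP => // _ /eqP.
  by rewrite sub0r oppr_eq0 oner_eq0.
move=> e; have := size_1subXn K (n %% m.+1).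
rewrite e pm_size ?pm_monic_1subXn // size_1subXnS.
have := ltn_pmod n (ltn0Sn m); move: nz; rewrite -size_poly_gt0; lia.
Qed.

Lemma qdvd_sum V n (F : 'I_n -> {poly K}) : (forall i, qdvd V (F i)) -> qdvd V (\sum_i F i).
Proof.
move=> h; elim/big_ind: _ => //; first by exists 0; rewrite mul0r.
by move=> x y [A ->] [B ->]; exists (A + B); rewrite mulrDl.
Qed.

(** Expand 1 - (1 - y)^M with y = 1 - z: the terms in y^l with 0 < l < k vanish, the later ones are
    multiples of y^k. *)
Lemma qdvd_exp_1subX (z : {poly K}) k M :
  (forall l, (0 < l < k)%N -> 'C(M, l)%:R = 0 :> K) -> qdvd ((1 - z) ^+ k) (1 - z ^+ M).
Proof.
move=> h; rewrite -{2}(subKr 1 z); move: (1 - z) => y.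
rewrite (exprDn 1) big_ord_recl /= subn0 bin0 expr1n expr0 mulr1 mulr1n opprD addrA subrr add0r. rewrite -sumrN.
apply: qdvd_sum => i; rewrite expr1n mul1r [bump 0 i]add1n.
have [hk|hk] := ltnP i.+1 k.
  by exists 0; rewrite -mulr_natr -polyC_natr h ?mulr0 ?mul0r ?oppr0.
exists (- ((-1) ^+ i.+1 * y ^+ (i.+1 - k) *+ 'C(M, i.+1))).
by rewrite mulNr mulrnAl -mulrA -exprD subnK // -exprNn.
Qed.

Lemma qdvd_qpoch_exp i L : (forall t, (t < i)%N -> (t.+1 %| L)%N) ->
  qdvd (qpoch K i) ((1 - 'X^L) ^+ i).
Proof.
elim: i => [|i IH] h; first by rewrite /qpoch big_ord0 expr0; apply: qdvd_refl.
rewrite qpochS [X in qdvd _ X]exprSr; apply: qdvd_mul; first by apply: IH => t ht; apply: h; apply: ltnW.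
exact: qdvd_1subXn (h _ _).
Qed.

End Divisibility.

(** * Valuations of lcm's and binomial coefficients *)

Section Arithmetic.

(** For x = [logn p t], t >= p^x >= 3^x > 2x. For p = t = 2 the bound fails. *)
Lemma double_logn_lt p t : prime p -> odd p -> 0 < t -> 2 * logn p t < t.
Proof.
move=> pp op t0; have p3 : 2 < p by have := prime_gt1 pp; move: op; case: p pp => [|[|[|]]].
apply: leq_trans (dvdn_leq t0 (pfactor_dvdnn p t)).
elim: (logn p t) => [|x IH] //.
rewrite expnS; nia.
Qed.

Definition lcm_upto m := \big[lcmn/1]_(t < m) t.+1.

Lemma lcm_upto_gt0 m : 0 < lcm_upto m.
Proof. by rewrite /lcm_upto; elim/big_ind: _ => // x y; rewrite lcmn_gt0 => -> ->. Qed.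

Lemma dvdn_lcm_upto m t : t < m -> t.+1 %| lcm_upto m.
Proof. by move=> h; apply: (dvdn_biglcmP _ _ _ (dvdnn _) (Ordinal h)). Qed.

Lemma lcm_upto_dvdn m n : (forall t, t < m -> t.+1 %| n) -> lcm_upto m %| n.
Proof. by move=> h; apply/dvdn_biglcmP => i _; apply: h. Qed.

Lemma double_logn_lcm p m : prime p -> odd p -> 0 < m -> 2 * logn p (lcm_upto m) < m.
Proof.
move=> pp op m0; have [] : lcm_upto m > 0 /\ 2 * logn p (lcm_upto m) < m; last by [].
rewrite /lcm_upto; elim/big_ind: _.
- by rewrite logn1.
- move=> x y [x0 hx] [y0 hy]; rewrite lcmn_gt0 x0 y0 logn_lcm //; split=> //; lia.
move=> i _; split=> //; apply: leq_trans (ltn_ord i).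
exact: double_logn_lt.
Qed.

Lemma dvdn_logn m n : 0 < m -> 0 < n ->
  (forall p, prime p -> p %| m -> logn p m <= logn p n) -> m %| n.
Proof.
move=> m0 n0 h; apply/dvdn_partP => // p hp.
rewrite p_part pfactor_dvdn ?h //; move: hp; rewrite mem_primes; by case/and3P.
Qed.

(* From l C(M,l) = M C(M-1,l-1), the p-adic valuation of C(M,l) is at least
   that of M minus that of l. *)
Lemma dvdn_bin_logn N M l : 0 < N -> 0 < l ->
  (forall p, prime p -> p %| N -> logn p N + logn p l <= logn p M) -> N %| 'C(M, l).
Proof.
case: l => // l N0 _ h.
have [hM|hM] := leqP l.+1 M; last by rewrite bin_small.
apply: dvdn_logn => // [|p pp pN]; first by rewrite bin_gt0.
rewrite -(leq_add2r (logn p l.+1)) (leq_trans (h p pp pN)) // addnC -lognM ?bin_gt0 //.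
rewrite -mul_bin_diag lognM ?leq_addr ?bin_gt0; lia.
Qed.

End Arithmetic.

(** * Minimal periods *)

Section MinPeriod.

Lemma period_mul u T c n : is_period u T -> u (n + c * T) = u n.
Proof. by case=> _ h; elim: c n => [|c IH] n; rewrite ?addn0 // mulSn addnA IH h. Qed.

Lemma min_periodP u T : is_period u T ->
  is_period u (min_period u) /\ min_period u %| T.
Proof.
move=> hT.
have [T0 hT0] : exists T0, is_min_period u T0.
  have ex : exists T0, boolp.asbool (is_period u T0) by exists T; apply/boolp.asboolP.
  have [m /boolp.asboolP hm min] := ex_minnP ex; exists m; split=> // T' hT'.
  by apply: min; apply/boolp.asboolP.
have [h1 h2] : is_min_period u (min_period u).
  by apply: (@classical_sets.xgetPex _ 0 (is_min_period u)); exists T0.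
split=> //; set t := min_period u in h1 h2 *.
have t0 : 0 < t by case: h1.
rewrite /dvdn; case: posnP => // r0.
(* The remainder of a period modulo the minimal one would be a smaller period. *)
have : is_period u (T %% t).
  split=> // n; rewrite -(period_mul (T %/ t) _ h1) -addnA (addnC (T %% t)) -divn_eq.
  by case: hT.
by move/h2; rewrite leqNgt ltn_mod t0.
Qed.

End MinPeriod.

(** * The periods modulo N *)

Section Periods.
Variables (N : nat) (N_gt1 : 1 < N).
Local Notation K := 'Z_N.
Local Notation "V %|q T" := (qdvd V (1 - 'X^T)%R) (at level 70).

Lemma natr_Zp_eq m n : (m%:R == n%:R :> K)%R = (m == n %[mod N]).
Proof. by rewrite -val_eqE /= !val_Zp_nat. Qed.

Lemma natr_Zp_eq0 m : (m%:R == 0 :> K)%R = (N %| m).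
Proof. by rewrite (natr_Zp_eq m 0) mod0n. Qed.

(** The product divides (1 - z)^(i+j) with z = q^L, and the valuations make N divide C(M,l) for 0 <
    l < i + j. *)
Lemma qpochM_qdvd i j L M :
  (forall t, t < maxn i j -> t.+1 %| L) ->
  (forall p l, prime p -> p %| N -> 0 < l < i + j ->
     logn p N + logn p l <= logn p M) ->
  (qpoch K i * qpoch K j)%R %|q (L * M).
Proof.
move=> hL hM; apply: (@qdvd_trans _ _ ((1 - 'X^L) ^+ (i + j))%R).
  rewrite exprD; apply: qdvd_mul; apply: qdvd_qpoch_exp => t ht; apply: hL.
    by rewrite leq_max ht.
  by rewrite leq_max ht orbT.
rewrite exprM; apply: qdvd_exp_1subX => l hl; apply/eqP; rewrite natr_Zp_eq0.
by apply: dvdn_bin_logn => [||p pp pN]; [lia | lia | apply: hM].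
Qed.

Lemma npart_periodP k T : 0 < k -> 0 < T ->
  is_period (fun n => npart_le k n %% N) T <-> qpoch K k %|q T.
Proof.
move=> k0 T0.
apply: (iff_trans _ (iff_sym (inv_series_periodP (pm_monic_qpoch K k)
  (size_qpoch_gt1 K k0) T0 (inv_series_npart K k)))).
split=> [[_ h] n | h]; first by apply/eqP; rewrite natr_Zp_eq; apply/eqP.
by split=> // n; apply/eqP; rewrite -natr_Zp_eq h.
Qed.

Lemma npart_period_spec k : 0 < k ->
  [/\ 0 < npart_period N k, qpoch K k %|q npart_period N k &
      forall T, 0 < T -> qpoch K k %|q T -> npart_period N k %| T].
Proof.
move=> k0.
have [T T0 hT] : exists2 T, 0 < T & qpoch K k %|q T.
  (* Each l < k divides k!, so N k! has the valuations that [qpochM_qdvd] asks for. *)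
  exists (lcm_upto k * (N * k`!)).
    by rewrite !muln_gt0 lcm_upto_gt0 fact_gt0 ltnW.
  have := @qpochM_qdvd k 0 (lcm_upto k) (N * k`!).
  rewrite {2}/qpoch big_ord0 mulr1 maxn0 addn0; apply; first exact: dvdn_lcm_upto.
  move=> p l _ _ /andP[l0 lk]; rewrite lognM ?fact_gt0 ?leq_add2l //; last exact: ltnW.
  by apply: dvdn_leq_log; rewrite ?fact_gt0 // dvdn_fact // l0 ltnW.
have [[h0 h1] _] := min_periodP (proj2 (npart_periodP k0 T0) hT).
split=> //; first by apply/npart_periodP.
by move=> S S0 /(npart_periodP k0 S0)/min_periodP[].
Qed.

Lemma npart_period_dvdS k : 0 < k -> npart_period N k %| npart_period N k.+1.
Proof.
move=> k0; have [_ _ h] := npart_period_spec k0; have [h0 h1 _] := npart_period_spec (ltn0Sn k).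
by apply: h => //; apply: qdvd_trans h1; apply: qdvd_qpoch.
Qed.

(** Merges the two cases of the definition: c is 1 or N, and the ratio times c is a multiple of N
    either way. *)
Lemma npart_period'S k : 0 < k -> exists2 c,
  npart_period' N k.+1 = npart_period N k.+1 %/ npart_period N k * npart_period' N k * c
  & 0 < c /\ N %| npart_period N k.+1 %/ npart_period N k * c.
Proof.
case: k => // k _; rewrite [npart_period' N k.+2]/=.
case: ifP => h; first by exists 1; rewrite muln1.
exists N; last by rewrite ltnW // dvdn_mull.
by rewrite -mulnA mulnC.
Qed.

Lemma npart_period'_spec k : 0 < k ->
  [/\ 0 < npart_period' N k, npart_period N k %| npart_period' N k &
      N ^ k.-1 %| npart_period' N k].
Proof.
elim: k => // -[|k] IH _.
  have [_ _ h] := npart_period_spec (ltn0Sn 0).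
  split; rewrite ?dvd1n //; apply: h => //.
  by rewrite /qpoch big_ord1; apply: qdvd_refl.
have [h0 h1 h2] := IH isT.
have [s0 _ _] := npart_period_spec (ltn0Sn k.+1).
have [s0' _ _] := npart_period_spec (ltn0Sn k).
have hd := npart_period_dvdS (ltn0Sn k).
have [c -> [c0 hc]] := npart_period'S (ltn0Sn k).
have r0 : 0 < npart_period N k.+2 %/ npart_period N k.+1 by rewrite divn_gt0 // dvdn_leq.
split; first by rewrite !muln_gt0 r0 h0.
  by rewrite -{1}(divnK hd) dvdn_mulr // dvdn_mul.
by rewrite mulnAC expnS dvdn_mul.
Qed.

(** The cofactor of (q)_k in 1 - q^T is one period of the partition counts; its value at q = 1 is
    the sum, so the factor theorem splits off another q - 1. *)
Lemma qdvd_npart_sum k T : 0 < T -> qpoch K k %|q T -> 0 < k ->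
  \sum_(0 <= i < T) npart_le k i = 0 %[mod N] ->
  ((1 - 'X) * qpoch K k)%R %|q T.
Proof.
move=> T0 hT k0 hs.
have [_ per] := proj2 (npart_periodP k0 T0) hT.
have e := @inv_series_periodic _ _ _ _ T0 (inv_series_npart K k).
have {}e := e (fun n => eqP (etrans (natr_Zp_eq _ _) (introT eqP (per n)))).
have : root (\poly_(i < T) (npart_le k i)%:R : {poly K})%R 1%R.
  rewrite /root horner_poly.
  have -> : (\sum_(i < T) (npart_le k i)%:R * 1 ^+ i = (\sum_(0 <= i < T) npart_le k i)%:R :> K)%R.
    by rewrite natr_sum big_mkord; apply: eq_bigr => i _; rewrite expr1n mulr1.
  by rewrite natr_Zp_eq0 /dvdn hs mod0n.
case/factor_theorem => A eA; exists (- A)%R; rewrite -e eA.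
rewrite polyC1; ring.
Qed.

(* The two extreme indices use the hypothesis on the sum; for the others
   T' = pi'(k-1) contains so many factors N that it is not needed. *)
Lemma qpochM_qdvd_period' k i : odd N -> 0 < i < k ->
  \sum_(0 <= i < npart_period N k.-1) npart_le k.-1 i = 0 %[mod N] ->
  (qpoch K i * qpoch K (k - i))%R %|q (i * npart_period' N k.-1).
Proof.
move=> oN hi hs; have k1 : 0 < k.-1 by lia.
have [p0 p1 _] := npart_period_spec k1; have [q0 q1 q2] := npart_period'_spec k1.
have extreme : ((1 - 'X) * qpoch K k.-1)%R %|q (i * npart_period' N k.-1).
  apply: (qdvd_trans (qdvd_npart_sum p0 p1 k1 hs)).
  by apply: qdvd_1subXn; apply: dvdn_mull.
have q1E : qpoch K 1 = (1 - 'X)%R by rewrite /qpoch big_ord1.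
have [hi1|[hi1|hi1]] : i = 1 \/ i = k.-1 \/ 1 < i < k.-1 by lia.
- by move: extreme; rewrite hi1 q1E subn1.
- have -> : k - i = 1 by lia.
  by move: extreme; rewrite q1E mulrC -hi1.
have k2 : 0 < k - 2 by lia.
(* Here both i and k - i are at most k - 2. *)
pose L := lcm_upto (k - 2).
have LT : L %| npart_period' N k.-1.
  apply: lcm_upto_dvdn => t ht; apply: dvdn_trans q1.
  apply: (@qdvd_1subXn_dvdn K) => //; apply: qdvd_trans p1.
  apply: (@qdvd_trans _ _ (qpoch K t.+1)); last by apply: qdvd_qpoch; lia.
  by rewrite qpochS mulrC; apply: qdvd_mulr.
have [M eM] := dvdnP LT.
have [M0 L0] : 0 < M /\ 0 < L by move: q0; rewrite eM muln_gt0 => /andP[].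
apply: (@qdvd_trans _ _ (1 - 'X^(L * M))%R); last first.
  by apply: qdvd_1subXn; rewrite eM (mulnC L) dvdn_mull.
apply: qpochM_qdvd => [t ht | p l pp pN hl].
  by apply: dvdn_lcm_upto; lia.
have op : odd p by apply: dvdn_odd pN oN.
have a1 : 0 < logn p N by rewrite logn_gt0 mem_primes pp pN ltnW.
have vT := dvdn_leq_log p q0 q2; rewrite lognX eM lognM // in vT.
have vL : 2 * logn p L < k - 2 by apply: double_logn_lcm.
have [l0 lk] : 0 < l /\ l < k by move: hl; rewrite subnKC; [case/andP | lia].
have vl := double_logn_lt pp op l0.
(* With v = [logn p]: v(M) + v(L) >= (k-2) v(N) >= v(N) + (k-3). As 2 v(L) <= k-3 and 2 v(l) <= k-2,
   v(L) + v(l) <= k-3, whence v(N) + v(l) <= v(M). *)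
have vN : logn p N + (k - 3) <= k.-1.-1 * logn p N.
  have -> : k.-1.-1 = (k - 3).+1 by clear -k2; lia.
  by rewrite mulSn leq_add2l leq_pmulr.
clear -k2 vT vL vl vN lk; lia.
Qed.

End Periods.

(** * Window boundaries and sums of periodic sequences *)

Lemma leq_wstart t i j : i <= j -> wstart t i <= wstart t j.
Proof. by move=> h; rewrite leq_add ?leq_mul2r ?h ?orbT ?leq_bin2l. Qed.

Lemma wstartS t j : wstart t j.+1 = wstart t j + (t + j).
Proof. by rewrite /wstart binS bin1; lia. Qed.

Lemma sum_shift_periodic (b : nat -> nat) Q s :
  (forall m, b (m + Q) = b m) -> \sum_(m < Q) b (m + s) = \sum_(m < Q) b m.
Proof.
move=> h; elim: s => [|s <-]; first by apply: eq_bigr => i _; rewrite addn0.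
case: Q h => [|Q] h; first by rewrite !big_ord0.
rewrite big_ord_recr [RHS]big_ord_recl /= addnC; congr (_ + _).
  by rewrite addnS -addSn addnC h.
by apply: eq_bigr => i _; rewrite /bump add1n addSnnS.
Qed.

Lemma sum_periodic (b : nat -> nat) Q l : (forall m, b (m + Q) = b m) ->
  \sum_(m < l + Q) b m = \sum_(m < l) b m + \sum_(m < Q) b m.
Proof.
move=> h; rewrite big_split_ord /=; congr (_ + _).
by rewrite -(sum_shift_periodic l h); apply: eq_bigr => i _; rewrite addnC.
Qed.

Lemma sum_windows (h : nat -> nat) t k :
  \sum_(m < wstart t k) h m = \sum_(j < k) \sum_(m < t + j) h (wstart t j + m).
Proof.
elim: k => [|k IH]; first by rewrite !big_ord0.
by rewrite big_ord_recr -IH wstartS big_split_ord.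
Qed.

(** * Coefficients on the windows *)

Section Windows.
Local Open Scope ring_scope.
Variables (K : comNzRingType) (k Q : nat) (B : {poly K}).
Hypotheses (k_gt0 : (0 < k)%N) (Q_gt0 : (0 < Q)%N) (BE : B * qpoch K k = 1 - 'X^Q).

(** This is (1 - q^Q) / V_j, obtained for every j from the single [B] = (1 - q^Q) / (q)_k. *)
Definition cofactor j := B * gbin K k j.

Lemma cofactorE j : (j <= k)%N ->
  cofactor j * (qpoch K j * qpoch K (k - j)) = 1 - 'X^Q.
Proof. by move=> h; rewrite -mulrA -{1}(subnKC h) gbin_fact subnKC. Qed.

Lemma pm_monic_qpochM i j : pm_monic (qpoch K i * qpoch K j).
Proof. by apply: pm_monicM; apply: pm_monic_qpoch. Qed.

Lemma size_qpochM_gt1 j : (j <= k)%N -> (1 < size (qpoch K j * qpoch K (k - j))%R)%N.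
Proof.
have nz i : qpoch K i != 0.
  have [->|/size_qpoch_gt1 h] := posnP i; first by rewrite /qpoch big_ord0 oner_neq0.
  by rewrite -size_poly_gt0 ltnW.
move=> h; rewrite pm_size ?pm_monic_qpoch //.
have := nz j; have := nz (k - j)%N; rewrite -!size_poly_gt0.
have [j0|j0] := posnP j.
  by have := @size_qpoch_gt1 K (k - j); rewrite j0; lia.
by have := size_qpoch_gt1 K j0; lia.
Qed.

Definition pcoef j m := rep_coef (cofactor j) Q m.

Lemma size_cofactorj j : (j <= k)%N -> (size (cofactor j) <= Q)%N.
Proof.
move=> h; apply: size_cofactor (cofactorE h) => //; first exact: pm_monic_qpochM.
exact: size_qpochM_gt1.
Qed.

Lemma inv_series_pcoef j : (j <= k)%N ->
  inv_series (qpoch K j * qpoch K (k - j)) (pcoef j).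
Proof. by move=> h; apply: inv_series_rep_coef (cofactorE h) => //; apply: size_cofactorj. Qed.

Lemma pcoef_periodic j S m : (j <= k)%N -> (0 < S)%N ->
  qdvd (qpoch K j * qpoch K (k - j)) (1 - 'X^S) -> pcoef j (m + S) = pcoef j m.
Proof.
move=> h S0 hd; apply: (proj1 (inv_series_periodP _ _ S0 (inv_series_pcoef h)) hd).
  exact: pm_monic_qpochM.
exact: size_qpochM_gt1.
Qed.

Lemma pcoef_modn j x y : x = y %[mod Q] -> pcoef j x = pcoef j y.
Proof. by rewrite /pcoef /rep_coef => ->. Qed.

Lemma coef_gbin n m : (k <= n)%N -> (gbin K n k)`_m =
  \sum_(j < k.+1) (if (wstart (n - k).+1 j <= m)%N then
                     (-1) ^+ j * pcoef j (m - wstart (n - k).+1 j) else 0).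
Proof.
(* Multiplying by 1 - q^((m+1)Q) does not affect coefficient m, and replaces each 1 / V_j by a
   polynomial truncation. *)
move=> h; have hm : (m < m.+1 * Q)%N by apply: leq_pmulr.
rewrite -(@eqX_1subXn K (m.+1 * Q) _ m hm) -geom_1subXn mulrAC.
rewrite (gbin_expansion h cofactorE) mulr_suml coef_sum; apply: eq_bigr => -[j hj] _ /=.
rewrite -mulrA -(mulrA _ (cofactor j)) rep_coefE ?size_cofactorj //.
have -> : (-1) ^+ j = ((-1) ^+ j)%:P :> {poly K} by rewrite rmorphXn rmorphN1.
rewrite coefCM coefXnM coef_poly (leq_ltn_trans (leq_subr _ _) hm) ltnNge.
by case: leqP => _; rewrite ?mulr0.
Qed.

(** The g_(j,n)(m) of the overview, with t = n - k + 1; defined for all m, hence periodic beyond its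
    window. *)
Definition wcoef t j m := \sum_(i < j.+1) (-1) ^+ i * pcoef i (wstart t j - wstart t i + m).

Lemma coef_gbin_window n j m : (k <= n)%N -> (j < k)%N -> (m < (n - k).+1 + j)%N ->
  (gbin K n k)`_(wstart (n - k).+1 j + m) = wcoef (n - k).+1 j m.
Proof.
move=> h hj hm; rewrite coef_gbin // /wcoef; set t := (n - k).+1 in hm *.
rewrite (big_ord_widen k.+1 (fun i => (-1) ^+ i * pcoef i (wstart t j - wstart t i + m))); last lia.
rewrite [RHS]big_mkcond; apply: eq_bigr => i _ /=; rewrite ltnS.
have [hi|hi] := leqP i j.
  by rewrite (leq_trans (leq_wstart t hi) (leq_addr _ _)) addnBAC // leq_wstart.
rewrite ifN // -ltnNge; apply: leq_trans (leq_wstart t hi).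
by rewrite wstartS ltn_add2l.
Qed.

(** Passing from t to t + s adds (j - i) s to s_j - s_i. The periods of [pcoef i] allow adding i s,
    which makes the shift j s for every i. *)
Lemma wcoef_shift t t' s j m : (j < k)%N -> t' = t + s %[mod Q] ->
  (forall i x, (i <= j)%N -> pcoef i (x + i * s) = pcoef i x) ->
  wcoef t' j m = wcoef t j (m + j * s).
Proof.
move=> hj ht hs; apply: eq_bigr => -[i hi] _ /=; congr (_ * _).
rewrite -[LHS]hs //; apply: pcoef_modn; rewrite ltnS in hi.
have e u : (wstart u j - wstart u i = (j - i) * u + ('C(j, 2) - 'C(i, 2)))%N.
  have := leq_bin2l 2 hi; rewrite /wstart mulnBl; have : (i * u <= j * u)%N by rewrite leq_mul2r hi orbT.
  lia.
rewrite !e.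
have -> : ((j - i) * t + ('C(j, 2) - 'C(i, 2)) + (m + j * s) =
   (j - i) * (t + s) + ('C(j, 2) - 'C(i, 2) + m + i * s))%N.
  have -> : (j * s = (j - i) * s + i * s)%N by rewrite -mulnDl subnK.
  ring.
have -> : ((j - i) * t' + ('C(j, 2) - 'C(i, 2)) + m + i * s =
   (j - i) * t' + ('C(j, 2) - 'C(i, 2) + m + i * s))%N by ring.
by apply/eqP; rewrite eqn_modDr -modnMmr ht modnMmr.
Qed.

Lemma wcoef_addQ t j m : (j < k)%N -> wcoef (t + Q) j m = wcoef t j m.
Proof.
move=> hj; rewrite (@wcoef_shift t _ 0) ?muln0 ?addn0 ?modnDr // => i x _.
by rewrite muln0 addn0.
Qed.

Lemma wcoef_periodic t j m : wcoef t j (m + Q) = wcoef t j m.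
Proof. by apply: eq_bigr => i _; congr (_ * _); apply: pcoef_modn; rewrite addnA modnDr. Qed.

Variable r : K.

Definition window_count t := (\sum_(j < k) \sum_(m < Q) (wcoef t j m == r))%N.

(** A shift by j s permutes the residues modulo Q, so each window keeps its count. *)
Lemma window_count_shift t t' s : t' = t + s %[mod Q] ->
  (forall i x, (i < k)%N -> pcoef i (x + i * s) = pcoef i x) ->
  window_count t' = window_count t.
Proof.
move=> ht hs; apply: eq_bigr => -[j hj] _ /=.
rewrite -(@sum_shift_periodic (fun m => (wcoef t j m == r) : nat) Q (j * s)).
  apply: eq_bigr => m _; rewrite (wcoef_shift _ _ ht) // => i x hi.
  exact: hs (leq_ltn_trans hi hj).
by move=> m; rewrite wcoef_periodic.
Qed.

(** Counts up to s_k, past the degree k(n-k), so that the range is exactly the union of the k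
    windows. *)
Definition ext_count n := (\sum_(m < wstart (n - k).+1 k) ((gbin K n k)`_m == r)%R)%N.

Lemma ext_count_addQ n : (k <= n)%N ->
  ext_count (n + Q) = (ext_count n + window_count (n - k).+1)%N.
Proof.
move=> h; have hQ : (k <= n + Q)%N by rewrite (leq_trans h) ?leq_addr.
rewrite /ext_count.
rewrite (sum_windows (fun m => ((gbin K (n + Q) k)`_m == r) : nat)).
rewrite (sum_windows (fun m => ((gbin K n k)`_m == r) : nat)) -big_split /=.
apply: eq_bigr => -[j hj] _ /=.
have e : ((n + Q - k).+1 = (n - k).+1 + Q)%N by lia.
pose b m := (wcoef (n - k).+1 j m == r) : nat.
transitivity (\sum_(m < (n - k).+1 + j + Q) b m)%N.
  rewrite -addnAC -e; apply: eq_bigr => m _.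
  rewrite coef_gbin_window //; congr ((_ == r) : nat).
  by move: (nat_of_ord m) => {}m; rewrite e wcoef_addQ.
rewrite sum_periodic; last by move=> m; rewrite /b wcoef_periodic.
congr (_ + _)%N; apply: eq_bigr => m _.
by rewrite coef_gbin_window.
Qed.

End Windows.

(** * Residues modulo N and the count of the statement *)

Section Count.
Variables (N : nat) (N_gt1 : 1 < N).
Local Notation K := 'Z_N.

Lemma intr_Zp_eq (x y : int) : (x%:~R == y%:~R :> K)%R = (x == y %[mod N])%Z.
Proof.
have e z : (z%:~R = (`|(z %% N)%Z|%N)%:R :> K)%R.
  rewrite {1}(divz_eq z N) intrD intrM -[(Posz N)%:~R%R]/(N%:R)%R pchar_Zp // mulr0 add0r.
  by rewrite -{1}(@gez0_abs (z %% N)%Z) // modz_ge0 //; lia.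
rewrite e (e y) natr_Zp_eq // !modn_small; last 2 first.
- by rewrite -ltz_nat gez0_abs ?modz_ge0 ?ltz_mod //; lia.
- by rewrite -ltz_nat gez0_abs ?modz_ge0 ?ltz_mod //; lia.
by rewrite -eqz_nat !gez0_abs ?modz_ge0 //; lia.
Qed.

(** The surplus positions carry coefficient 0 and their number does not depend on n, so they cancel
    in differences. *)
Lemma gauss_countE k R n : k <= n -> 0 < k ->
  ext_count k (R%:~R : K)%R n =
  gauss_count N k R n + (k.-1 + 'C(k, 2)) * ((0 : K) == R%:~R)%R.
Proof.
move=> h k0; rewrite /ext_count.
have -> : wstart (n - k).+1 k = (k * (n - k)).+1 + (k.-1 + 'C(k, 2)).
  by rewrite /wstart mulnS; lia.
rewrite big_split_ord /=; congr (_ + _).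
  rewrite /gauss_count -sum1_card [RHS]big_mkcond; apply: eq_bigr => i _.
  rewrite inE -intr_Zp_eq gaussE // -map_gbin coef_map /=.
  by case: ifP.
rewrite -[k.-1 + _ in RHS]card_ord -sum_nat_const; apply: eq_bigr => i _.
by rewrite nth_default // (leq_trans (size_gbin _ h)) // addSn ltnS leq_addr.
Qed.

End Count.

Lemma gauss_count1 k R n : gauss_count 1 k R n = (k * (n - k)).+1.
Proof.
rewrite /gauss_count -[RHS]card_ord; apply: eq_card => i.
by rewrite !inE !modz1.
Qed.

Theorem theorem5p2 (N k : nat) (R : int) :
  odd N -> 2 <= k ->
  \sum_(0 <= i < npart_period N k.-1) npart_le k.-1 i = 0 %[mod N] ->
  let Q := npart_period' N k in
  forall n n' : nat, k <= n -> k <= n' ->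
    n' = n + npart_period' N k.-1 %[mod Q] ->
    ((gauss_count N k R (n + Q))%:Z - (gauss_count N k R n)%:Z =
     (gauss_count N k R (n' + Q))%:Z - (gauss_count N k R n')%:Z)%R.
Proof.
move=> oN k2 hs Q n n' hn hn' e.
(* N = 1 is treated apart because ['Z_1] has two elements; there f(n) = k(n-k) + 1. *)
have [N1|N1] := leqP N 1.
  have -> : N = 1 by case: N N1 oN {hs Q e} => [|[]].
  rewrite !gauss_count1 -!addnBAC // !mulnDr; clear; lia.
have k0 : 0 < k by lia.
have k1 : 0 < k.-1 by lia.
have [Q0 hpQ _] := npart_period'_spec N1 k0.
have [T0 _ _] := npart_period'_spec N1 k1.
have [_ hp _] := npart_period_spec N1 k0.
have [B BE] := qdvd_trans hp (@qdvd_1subXn 'Z_N _ _ hpQ).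
pose D m := window_count k Q B (R%:~R : 'Z_N)%R (m - k).+1.
have step m : k <= m -> gauss_count N k R (m + Q) = gauss_count N k R m + D m.
  move=> hm; have := @ext_count_addQ 'Z_N k Q B k0 Q0 (esym BE) (R%:~R)%R m hm.
  by rewrite !gauss_countE ?(leq_trans hm) ?leq_addr // addnAC => /addIn.
have eD : D n' = D n.
  apply: (@window_count_shift _ _ _ _ k0 Q0 _ _ _ (npart_period' N k.-1)).
    (* Adding k - 1 turns (m - k) + 1 back into m. *)
    apply/eqP; rewrite -(eqn_modDr k.-1).
    have tE m : k <= m -> (m - k).+1 + k.-1 = m by clear -k0; lia.
    by rewrite addnAC !tE //; apply/eqP.
  move=> i x hi; have [->|i0] := posnP i; first by rewrite mul0n addn0.
  apply: (@pcoef_periodic _ k); rewrite ?muln_gt0 ?i0 // ?(ltnW hi) //.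
  by apply: qpochM_qdvd_period'; rewrite ?i0.
by rewrite (step n) // (step n') // eD !PoszD ![(_ + (D n)%:Z)%R]addrC !addrK.
Qed.
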